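(* Every finite-dimensional semi-simple left central Leibniz algebra over a field of characteristic zero is a Lie algebra.
   Context: A left Leibniz algebra over a field $\mathbb{F}$ is an $\mathbb{F}$-vector space $\mathfrak{L}$ with a bilinear multiplication satisfying $x(yz)=(xy)z+y(xz)$ for all $x,y,z\in\mathfrak{L}$. Ideals are two-sided. The Leibniz kernel is the ideal $\mathrm{Leib}(\mathfrak{L}):=\langle x^2\mid x\in\mathfrak{L}\rangle_{\mathbb{F}}$ (the linear span of all squares). $\mathfrak{L}$ is semi-simple if $\mathrm{Leib}(\mathfrak{L})$ contains every solvable ideal of $\mathfrak{L}$. The right center is $C^r(\mathfrak{L}):=\{c\in\mathfrak{L}\mid\forall\,x\in\mathfrak{L}:xc=0\}$. A left central Leibniz algebra is a left Leibniz algebra $\mathfrak{L}$ with $\mathrm{Leib}(\mathfrak{L})\subseteq C^r(\mathfrak{L})$. *)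

(* Defs.v *)
From mathcomp Require Import all_boot all_order all_algebra.

Set Implicit Arguments.
Unset Strict Implicit.
Unset Printing Implicit Defensive.

Import GRing.Theory.
Local Open Scope ring_scope.

Section LeibnizAlgebras.

Variables (F : fieldType) (L : vectType F).

(* Linear span of an arbitrary, possibly infinite, set of vectors: the vectors
   that lie in the span of some finite family of members of the set. *)
Definition lspan (P : L -> Prop) (v : L) : Prop :=
  exists2 s : seq L, {in s, forall u, P u} & v \in <<s>>%VS.

Variable mul : {bilinear L -> L -> L}.

Definition left_leibniz : Prop :=
  forall x y z : L, mul x (mul y z) = mul (mul x y) z + mul y (mul x z).

Definition lie : Prop :=
  (forall x : L, mul x x = 0) /\
  (forall x y z : L, mul x (mul y z) + mul y (mul z x) + mul z (mul x y) = 0).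

Definition ideal (I : {vspace L}) : Prop :=
  forall a x : L, a \in I -> mul x a \in I /\ mul a x \in I.

Definition leib : L -> Prop :=
  lspan (fun v => exists x : L, v = mul x x).

Fixpoint derived (I : {vspace L}) (n : nat) : L -> Prop :=
  match n with
  | 0 => fun v => v \in I
  | n'.+1 => lspan (fun v => exists x y : L,
      [/\ derived I n' x, derived I n' y & v = mul x y])
  end.

Definition solvable_subspace (I : {vspace L}) : Prop :=
  exists n : nat, forall v : L, derived I n v -> v = 0.

Definition semisimple_leibniz : Prop :=
  forall I : {vspace L}, ideal I -> solvable_subspace I ->
  forall v : L, v \in I -> leib v.

Definition right_center (c : L) : Prop := forall x : L, mul x c = 0.

Definition left_central_leibniz : Prop :=
  left_leibniz /\ (forall v : L, leib v -> right_center v).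

End LeibnizAlgebras.

(* Main.v *)
Require Import Defs.
From HB Require Import structures.
From mathcomp Require Import all_boot all_order all_algebra all_field.
From Stdlib Require Import Classical.

(* Put kappa(x, y) = tr (l_x l_y), where l_x is left multiplication by x on L.
   Its radical R is an ideal, and R is solvable: if J is the last term of its
   derived series, Cartan's argument shows that l_x is nilpotent for x in J, so
   Engel's theorem forces the perfect algebra J to vanish. By semi-simplicity
   R lies in Leib(L), hence in the right center. Now let mu be a linear form. As
   mu(x z) = 0 for z in R, there is a linear map d with mu(x z) = kappa(d x, z),
   and the Leibniz identity makes d a derivation modulo R. Therefore l_(d x) and
   [d, l_x] agree up to a map that left multiplications kill, so that
   mu(x x) = kappa(d x, x) = tr ([d, l_x] l_x) = 0. *)

Set Implicit Arguments.
Unset Strict Implicit.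
Unset Printing Implicit Defensive.

Import Order.TTheory GRing.Theory Num.Theory.
Local Open Scope ring_scope.

(** * Triangularization over an extension field *)

Lemma irreducible_factor_exists (F : fieldType) (p : {poly F}) :
  (1 < size p)%N -> exists2 q, irreducible_poly q & q %| p.
Proof.
have [n] := ubnP (size p); elim: n p => // n IHn p; rewrite ltnS => le_pn p_gt1.
have p_neq0 : p != 0 by rewrite -size_poly_gt0 ltnW.
have [irr_p | red_p] := classic (irreducible_poly p); first by exists p.
have [q [q_size q_dv_p neq_qp]] :
    exists q : {poly F}, [/\ size q != 1%N, q %| p & ~~ (q %= p)].
  apply: NNPP => no_q; apply: red_p; split=> // q q_size q_dv_p.
  by apply: contra_notT no_q => neq_qp; exists q.
have q_neq0 : q != 0 by apply: contraTneq q_dv_p => ->; rewrite dvd0p.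
have lt_qp : (size q < size p)%N.
  by rewrite ltn_neqAle dvdp_leq // dvdp_size_eqp // neq_qp.
have q_gt1 : (1 < size q)%N by rewrite ltn_neqAle eq_sym q_size size_poly_gt0.
have [r irr_r r_dv_q] := IHn q (leq_trans lt_qp le_pn) q_gt1.
by exists r => //; apply: dvdp_trans q_dv_p.
Qed.

(** A root of an irreducible factor of the characteristic polynomial is adjoined. A single
    eigenvalue is enough because the triangularization enlarges the field anew at each step. *)
Lemma eigenvalue_ext (F : fieldType) n (A : 'M[F]_n.+1) :
  exists (K : fieldType) (f : {rmorphism F -> K}) (a : K),
    eigenvalue (map_mx f A) a.
Proof.
have [|q irr_q /dvdpP [u Du]] := @irreducible_factor_exists F (char_poly A).
  by rewrite size_char_poly.
have [K _ [a qa0 _]] := irredp_FAdjoin irr_q.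
exists K, (in_alg K), a; rewrite eigenvalue_root_char -map_char_poly Du.
by rewrite rmorphM rootM qa0 orbT.
Qed.

Lemma eigenvalue_deflation (K : fieldType) n (A : 'M[K]_(1 + n)) a :
  eigenvalue A a -> exists (P : 'M_(1 + n)) (x : 'M_1) (c : 'cV_n) (B : 'M_n),
    P \in unitmx /\ P *m A = block_mx x 0 c B *m P.
Proof.
case/eigenvalueP=> v vA v_neq0; pose P := row_ebase v.
have uP : P \in unitmx := row_ebase_unit v.
(* The row [v] has rank one, so its decomposition through [pid_mx 1] makes it a multiple of the
   first row of [P]. *)
have Dv : v = (col_ebase v 0 0) *: row 0 P.
  have D1 : pid_mx 1 = delta_mx 0 0 :> 'rV[K]_(1 + n).
    by apply/rowP=> j; rewrite !mxE; case: j => [[|j]].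
  rewrite -[LHS]mulmx_ebase rank_rV v_neq0 D1 -mulmxA -rowE -mul_scalar_mx.
  by rewrite -mx11_scalar.
have b_neq0 : col_ebase v 0 0 != 0.
  by apply: contraNneq v_neq0 => b0; rewrite Dv b0 scale0r.
have PA : row 0 P *m A = a *: row 0 P.
  apply: (scalerI b_neq0); rewrite scalemxAl -Dv vA [in LHS]Dv.
  by rewrite !scalerA mulrC.
have [B DB] : {B : 'M_(1 + n) | B = P *m A *m invmx P}.
  by exists (P *m A *m invmx P).
exists P, (ulsubmx B), (dlsubmx B), (drsubmx B); split=> //.
suffices <- : ursubmx B = 0 by rewrite submxK DB mulmxKV.
have /rowP B0 : row 0 B = a *: row 0 1%:M.
  by rewrite DB !row_mul PA -scalemxAl -row_mul mulmxV.
apply/matrixP=> i j; move: (B0 (rshift 1 j)); rewrite !mxE mulr0 => <-.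
by congr (B _ _); apply: val_inj; rewrite ord1.
Qed.

(** Deflate by one eigenvector, then recurse on the lower block; the induction generalizes the
    field, which grows at every step. *)
Lemma trigonalizable_ext n (F : fieldType) (A : 'M[F]_n) :
  exists (K : fieldType) (f : {rmorphism F -> K}) (P T : 'M[K]_n),
    [/\ P \in unitmx, is_trig_mx T & P *m map_mx f A = T *m P].
Proof.
elim: n F A => [|n IHn] F A.
  exists F, idfun, 1%:M, A; split; rewrite ?unitmx1 ?[A]flatmx0 ?mx0_is_trig //.
  by rewrite map_mx0 mulmx0 mul0mx.
rewrite -[n.+1]/(1 + n)%N in A *.
have [L [f [a Aa]]] := eigenvalue_ext A.
have [Q [x [c [B [uQ QA]]]]] := eigenvalue_deflation Aa.
have [K [g [P [T [uP trigT PB]]]]] := IHn L B.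
exists K, (g \o f), (block_mx 1%:M 0 0 P *m map_mx g Q).
exists (block_mx (map_mx g x) 0 (P *m map_mx g c) T); split.
- by rewrite unitmx_mul map_unitmx uQ andbT block_diag_mx_unit unitmx1.
- by rewrite is_trig_block_mx // eqxx trigT mx11_is_trig.
rewrite (map_mx_comp f g) -[LHS]mulmxA -(map_mxM g) QA map_mxM !mulmxA.
congr (_ *m _).
rewrite map_block_mx map_mx0 !mulmx_block PB.
by rewrite !(mul1mx, mul0mx, mulmx0, mulmx1, add0r, addr0).
Qed.

(** * Integral functionals and polynomial interpolation *)

Lemma pchar0_intr_eq0 (K : fieldType) (z : int) :
  [pchar K] =i pred0 -> (z%:~R == 0 :> K) = (z == 0).
Proof.
move/pcharf0P=> char0; case: z => k; first by rewrite -pmulrn char0.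
by rewrite NegzE mulrNz oppr_eq0 -pmulrn char0.
Qed.

Lemma clear_denominators m (u : 'I_m -> rat) :
  exists (d : int) (v : 'I_m -> int),
    d != 0 /\ forall i, (v i)%:~R = d%:~R * u i.
Proof.
exists (\prod_i denq (u i)).
exists (fun i => numq (u i) * \prod_(j | j != i) denq (u j)).
split=> [|i]; first by apply/prodf_neq0=> i _; rewrite denq_neq0.
by rewrite [in RHS](bigD1 i) //= !intrM numqE [u i * _]mulrC mulrAC.
Qed.

(** Independent relations are stacked until the rank, bounded by [n], can no longer grow. As [rel]
    is an arbitrary predicate, the argument is by contradiction. *)
Lemma maximal_relation_matrix n (rel : 'rV[int]_n -> Prop) :
  exists m (M : 'M[int]_(m, n)), (forall i, rel (row i M)) /\
    forall q, rel q -> (map_mx (intr : int -> rat) q <= map_mx intr M)%MS.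
Proof.
pose good m (M : 'M[int]_(m, n)) := forall i, rel (row i M).
pose toQ m (M : 'M[int]_(m, n)) := map_mx (intr : int -> rat) M.
apply: NNPP => noM.
suffices /(_ n.+1) [m [M [_]]] : forall k, exists m (M : 'M[int]_(m, n)),
    good m M /\ (k <= \rank (toQ m M))%N.
  by rewrite leqNgt ltnS rank_leq_col.
elim=> [|k [m [M [goodM leM]]]]; first by exists 0, 0; split=> [[]|].
have [q [rel_q qM]] : exists q, rel q /\ ~~ (toQ 1 q <= toQ m M)%MS.
  apply: NNPP => no_q; apply: noM; exists m, M; split=> // q rel_q.
  by apply: contra_notT no_q => qM; exists q.
exists (1 + m)%N, (col_mx q M); split=> [i|].
  rewrite -[i]splitK; case: split => j /=; rewrite ?rowKu ?rowKd //.
  by rewrite [j]ord1 row_id.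
rewrite (leq_ltn_trans leM) // /toQ map_col_mx -addsmxE.
rewrite ltn_neqAle mxrankS ?addsmxSr // andbT.
apply: contra qM => /eqP eq_rk; rewrite (submx_trans (addsmxSl _ (toQ m M))) //.
by rewrite -(geq_leqif (mxrank_leqif_sup (addsmxSr _ _))) -eq_rk.
Qed.

(** This stands for a Q-linear functional on the Q-span of the [l i], with value [c i] at [l i]. The
    integral relations span a proper subspace of Q^n, so a nonzero rational functional kills them;
    clearing denominators makes it integral. *)
Lemma integral_functional (K : fieldType) n (l : 'I_n -> K) :
  [pchar K] =i pred0 -> (exists i, l i != 0) ->
  exists c : 'I_n -> int, (exists i, c i != 0) /\
    forall q : 'I_n -> int, \sum_i l i *~ q i = 0 -> \sum_i q i * c i = 0.
Proof.
move=> char0 [i0 li0].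
have [m [M [relM maxM]]] :=
  maximal_relation_matrix (fun q : 'rV[int]_n => \sum_i l i *~ q 0 i = 0).
pose MQ := map_mx (intr : int -> rat) M.
have : cokermx MQ != 0.
  (* If the relations had full rank, the unit vector at [i0] would be a rational combination of
     them, and some nonzero integer [d] would annihilate [l i0], against characteristic zero. *)
  rewrite cokermx_eq0; apply: contra li0 => /row_fullP [B BM].
  have [d [v [d_neq0 Dv]]] := clear_denominators (fun k => B i0 k).
  have Dvd j : \sum_k v k * M k j = d *+ (i0 == j).
    apply: (@intr_inj rat); rewrite rmorph_sum /= rmorphMn /=.
    under eq_bigr do rewrite intrM Dv -mulrA.
    rewrite -mulr_sumr -mulr_natr; congr (_ * _).
    move/matrixP/(_ i0 j): BM; rewrite !mxE => <-.
    by apply: eq_bigr => k _; rewrite mxE.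
  suffices : l i0 *~ d = 0.
    move/eqP; rewrite -mulrzr mulf_eq0 pchar0_intr_eq0 //.
    by rewrite (negPf d_neq0) orbF.
  have -> : l i0 *~ d = \sum_j l j *~ (d *+ (i0 == j)).
    rewrite (bigD1 i0) //= eqxx mulr1n big1 ?addr0 // => j.
    by rewrite eq_sym => /negPf->; rewrite mulr0n mulr0z.
  under eq_bigr do rewrite -Dvd mulrz_sumr.
  rewrite exchange_big big1 //= => k _.
  under eq_bigr do rewrite mulrC mulrzA.
  rewrite -mulrz_suml.
  by have:= relM k; under eq_bigr do rewrite mxE; move=> ->; rewrite mul0rz.
have [C DC] : {C | C = cokermx MQ} by exists (cokermx MQ).
rewrite -DC => /matrix0Pn[j [k cjk]].
have [d [c [d_neq0 Dc]]] := clear_denominators (fun i => C i k).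
exists c; split=> [|q rel_q].
  by exists j; rewrite -(intr_eq0 rat) Dc mulf_neq0 // intr_eq0.
apply: (@intr_inj rat); rewrite rmorph_sum /=.
have /maxM : \sum_i l i *~ (\row_i q i) 0 i = 0.
  by rewrite -[RHS]rel_q; apply: eq_bigr => i _; rewrite mxE.
rewrite submxE -/MQ -DC => /eqP/matrixP/(_ 0 k); rewrite !mxE => qk0.
rewrite -[RHS](mulr0 d%:~R) -[in RHS]qk0 mulr_sumr.
by apply: eq_bigr => i _; rewrite !mxE intrM Dc mulrCA.
Qed.

Lemma coprimep_prod_XsubC_pow (K : fieldType) (s : seq K) x N :
  x \notin s -> coprimep (\prod_(y <- s) ('X - y%:P) ^+ N) (('X - x%:P) ^+ N).
Proof.
move=> s'x; apply: coprimep_expr; rewrite coprimep_XsubC; apply/rootP/eqP.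
rewrite horner_prod prodf_seq_neq0; apply/allP=> y s_y /=.
by rewrite !hornerE expf_neq0 // subr_eq0; apply: contraNneq s'x => ->.
Qed.

Lemma poly_chinese_powers (K : fieldType) (s : seq K) (f : K -> K) N :
  exists p : {poly K}, {in s, forall x, ('X - x%:P) ^+ N %| p - (f x)%:P}.
Proof.
elim: s => [|x s [p Dp]]; first by exists 0.
have [s_x | s'x] := boolP (x \in s).
  by exists p => y; rewrite inE => /predU1P[->|]; apply: Dp.
pose Q := \prod_(y <- s) ('X - y%:P) ^+ N.
have /Bezout_eq1_coprimepP[[u w] /= Duw] := coprimep_prod_XsubC_pow N s'x.
(* The correction is a multiple of [Q], which preserves the earlier congruences, while [u * Q] is 1
   modulo the new power, which replaces [p] by [f x] there. *)
exists (p + ((f x)%:P - p) * (u * Q)) => y; rewrite inE => /predU1P[-> | s_y].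
  have -> : u * Q = 1 - w * ('X - x%:P) ^+ N by rewrite -Duw addrK.
  rewrite mulrBr mulr1 addrA [p + _]addrC subrK addrAC subrr add0r.
  by rewrite dvdpNr mulrA dvdp_mull.
rewrite addrAC dvdp_addr ?dvdp_mull ?Dp // /Q (big_rem y) //= dvdp_mulr //.
Qed.

(** * Polynomials in an endomorphism *)

Section PolyOfLinear.

Variables (K : fieldType) (V : lmodType K) (T : {linear V -> V}).
Implicit Types (p q : {poly K}) (u v w : V) (a c : K).

(** The operator p(T) on an abstract module, meant for [ad_mx A] acting on the space of matrices. *)
Definition lin_horner (p : {poly K}) (v : V) :=
  \sum_(i < size p) p`_i *: iter i T v.

Lemma lin_horner_widen m p v : (size p <= m)%N ->
  lin_horner p v = \sum_(i < m) p`_i *: iter i T v.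
Proof.
pose G i := p`_i *: iter i T v => le_pm.
rewrite /lin_horner (big_ord_widen _ G le_pm) big_mkcond.
apply: eq_bigr => i _; case: ltnP => // le_pi.
by rewrite /G nth_default ?scale0r.
Qed.

Lemma iter_linearD i u v : iter i T (u + v) = iter i T u + iter i T v.
Proof. by elim: i => //= i ->; rewrite linearD. Qed.

Lemma lin_hornerDr p u v :
  lin_horner p (u + v) = lin_horner p u + lin_horner p v.
Proof.
by rewrite -big_split; apply: eq_bigr => i _; rewrite iter_linearD scalerDr.
Qed.

Lemma lin_horner_sumr p (I : Type) (r : seq I) (F : I -> V) :
  lin_horner p (\sum_(i <- r) F i) = \sum_(i <- r) lin_horner p (F i).
Proof.
apply: (big_morph (lin_horner p) (lin_hornerDr p)).
by apply: (addIr (lin_horner p 0)); rewrite -lin_hornerDr !add0r.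
Qed.

Lemma lin_hornerD p q v :
  lin_horner (p + q) v = lin_horner p v + lin_horner q v.
Proof.
pose m := maxn (size p) (size q).
rewrite !(@lin_horner_widen m) ?leq_maxl ?leq_maxr ?size_polyD // -big_split.
by apply: eq_bigr => i _; rewrite coefD scalerDl.
Qed.

Lemma lin_hornerZ a p v : lin_horner (a *: p) v = a *: lin_horner p v.
Proof.
rewrite (lin_horner_widen _ (size_scale_leq a p)) scaler_sumr.
by apply: eq_bigr => i _; rewrite coefZ scalerA.
Qed.

Lemma lin_hornerC c v : lin_horner c%:P v = c *: v.
Proof. by rewrite (lin_horner_widen _ (size_polyC_leq1 c)) big_ord1 coefC. Qed.

Lemma lin_horner_mulX p v : lin_horner (p * 'X) v = lin_horner p (T v).
Proof.
rewrite (@lin_horner_widen (size p).+1); last first.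
  by rewrite (leq_trans (size_polyMleq _ _)) // size_polyX addn2.
rewrite big_ord_recl coefMX /= scale0r add0r.
by apply: eq_bigr => i _; rewrite coefMX /= -iterS iterSr.
Qed.

Lemma lin_horner_mulXsubC p a v :
  lin_horner (p * ('X - a%:P)) v = lin_horner p (T v - a *: v).
Proof.
apply: (addIr (lin_horner p (a *: v))); rewrite -lin_hornerDr subrK.
have -> : lin_horner p (a *: v) = lin_horner (a *: p) v.
  rewrite lin_hornerZ scaler_sumr; apply: eq_bigr => i _.
  rewrite scalerA mulrC -scalerA; congr (_ *: _).
  by elim: (i : nat) => //= k ->; rewrite linearZ.
by rewrite -lin_hornerD mulrBr [p * _%:P]mulrC mul_polyC subrK lin_horner_mulX.
Qed.

(** Modulo a power of X - a that annihilates [v], the polynomial [p] is the constant [c]. *)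
Lemma lin_horner_gen_eigen p a c m v :
    ('X - a%:P) ^+ m %| p - c%:P -> iter m (fun w => T w - a *: w) v = 0 ->
  lin_horner p v = c *: v.
Proof.
move=> /dvdpP[u Du] v0; rewrite -[p](subrK c%:P) lin_hornerD lin_hornerC Du.
suffices -> : lin_horner (u * ('X - a%:P) ^+ m) v = 0 by rewrite add0r.
elim: m v v0 {Du} => [v /= ->|m IHm v v0].
  by apply: (addIr (lin_horner (u * 1) 0)); rewrite -lin_hornerDr !add0r.
by rewrite exprSr mulrA lin_horner_mulXsubC IHm // -iterSr.
Qed.

End PolyOfLinear.

(** * Cartan's nilpotency criterion *)

Lemma mul_trig_mx (R : pzSemiRingType) n (A B : 'M[R]_n) :
    is_trig_mx A -> is_trig_mx B ->
  is_trig_mx (A *m B) /\ forall i, (A *m B) i i = A i i * B i i.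
Proof.
move=> /is_trig_mxP trA /is_trig_mxP trB; split=> [|i].
  apply/is_trig_mxP=> i j lt_ij; rewrite mxE big1 // => k _.
  have [lt_ik | le_ki] := ltnP i k; first by rewrite trA ?mul0r.
  by rewrite trB ?mulr0 // (leq_ltn_trans le_ki).
rewrite mxE (bigD1 i) //= big1 ?addr0 // => k.
rewrite neq_ltn => /orP[lt_ki|lt_ik].
  by rewrite trB ?mulr0.
by rewrite trA ?mul0r.
Qed.

Lemma horner_trig_mx (R : comNzRingType) n (T : 'M[R]_n.+1) p :
    is_trig_mx T ->
  is_trig_mx (horner_mx T p) /\ forall i, horner_mx T p i i = p.[T i i].
Proof.
move=> trT; elim/poly_ind: p => [|p c [trp Dp]].
  by rewrite rmorph0; split=> [|i]; rewrite ?mx0_is_trig // mxE horner0.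
rewrite rmorphD rmorphM /= horner_mx_X horner_mx_C.
have [/is_trig_mxP trpT DpT] := mul_trig_mx trp trT.
have /is_trig_mxP trc := scalar_mx_is_trig n.+1 c; split=> [|i].
  by apply/is_trig_mxP=> i j lt_ij; rewrite mxE trc // [X in X + _]trpT ?addr0.
by rewrite mxE [X in X + _]DpT Dp !hornerE mxE eqxx.
Qed.

Lemma mul_horner_mx_similar (R : comNzRingType) n (A P T : 'M[R]_n.+1) p :
  P *m A = T *m P -> P *m horner_mx A p = horner_mx T p *m P.
Proof.
move=> PA; elim/poly_ind: p => [|p c IHp].
  by rewrite !rmorph0 mulmx0 mul0mx.
rewrite !rmorphD !rmorphM /= !horner_mx_X !horner_mx_C mulmxDr mulmxDl.
by rewrite mulmxA IHp -!mulmxA PA scalar_mxC.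
Qed.

Lemma mxtrace_horner_trig (K : fieldType) n (A P T : 'M[K]_n.+1) p :
    P \in unitmx -> is_trig_mx T -> P *m A = T *m P ->
  \tr (horner_mx A p) = \sum_i p.[T i i].
Proof.
move=> uP trT PA; have -> : \tr (horner_mx A p) = \tr (horner_mx T p).
  rewrite -[in LHS](mulKmx uP (horner_mx A p)) (mul_horner_mx_similar _ PA).
  by rewrite mxtrace_mulC mulmxK.
by apply: eq_bigr => i _; have [_ ->] := horner_trig_mx p trT.
Qed.

Lemma horner_mx_similar_char_poly (K : fieldType) n (A P T : 'M[K]_n.+1) :
  P \in unitmx -> P *m A = T *m P -> horner_mx A (char_poly T) = 0.
Proof.
move=> uP PA; apply: (can_inj (mulKmx uP)); rewrite mulmx0.
by rewrite (mul_horner_mx_similar _ PA) Cayley_Hamilton mul0mx.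
Qed.

(** No root occurs more than [size s] times, so the product divides the power [size s] of its
    squarefree part [W], and the factors of that power are pairwise coprime. *)
Lemma dvdp_prod_XsubC_pow (K : fieldType) (s : seq K) (p : {poly K}) :
    (forall x, x \in s -> ('X - x%:P) ^+ size s %| p) ->
  \prod_(x <- s) ('X - x%:P) %| p.
Proof.
move=> dv_p; pose W := \prod_(x <- undup s) ('X - x%:P).
have dvW : W ^+ size s %| p.
  have : all (fun x => ('X - x%:P) ^+ size s %| p) (undup s).
    by apply/allP=> x; rewrite mem_undup; apply: dv_p.
  rewrite -prodrXl; elim: (undup s) (undup_uniq s) => [|x r IHr] /=.
    by rewrite big_nil dvd1p.
  case/andP=> r'x /IHr {}IHr /andP[dvx /IHr dvr].
  rewrite big_cons Gauss_dvdp ?dvx //.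
  by rewrite coprimep_sym coprimep_prod_XsubC_pow.
apply: dvdp_trans dvW.
have : all (mem (undup s)) s by apply/allP=> x s_x; rewrite inE mem_undup.
rewrite {dv_p}/W; elim: s (undup s) => [|x s IHs] r /=.
  by rewrite big_nil dvd1p.
case/andP=> r_x /IHs dv_s; rewrite big_cons exprS dvdp_mul //.
by rewrite (big_rem x) //= dvdp_mulr.
Qed.

(** * The adjoint action on matrices *)

Section AdjointAction.

Variables (K : fieldType) (n : nat) (A : 'M[K]_n).

Definition ad_mx (Z : 'M[K]_n) : 'M_n := A *m Z - Z *m A.

Fact ad_mx_linear : linear ad_mx.
Proof.
move=> a X Y; rewrite /ad_mx mulmxDr mulmxDl -scalemxAr -scalemxAl scalerBr.
by rewrite opprD addrACA.
Qed.
HB.instance Definition _ := GRing.isLinear.Build K _ _ _ ad_mx ad_mx_linear.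

(** The operator ad A - (x - y) is left multiplication by A - x minus right multiplication by A - y,
    and these two commute. Any product of a + b of them has at least a factors of the first kind or
    b of the second, so it kills [Z]. *)
Lemma iter_ad_mx_gen_eigen a b x y (Z : 'M[K]_n) :
    iter a (mulmx (A - x%:M)) Z = 0 -> iter b (mulmxr (A - y%:M)) Z = 0 ->
  iter (a + b) (fun W => ad_mx W - (x - y) *: W) Z = 0.
Proof.
pose Lx : 'M_n -> 'M_n := mulmx (A - x%:M).
pose Ry : 'M_n -> 'M_n := mulmxr (A - y%:M).
pose N W := ad_mx W - (x - y) *: W; rewrite -/Lx -/Ry -/N.
have ND W : N W = Lx W - Ry W.
  rewrite /N /Lx /Ry /= /ad_mx mulmxBl mulmxBr mul_scalar_mx mul_mx_scalar.
  rewrite scalerBl !opprB addrACA [in RHS]addrACA.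
  by congr (_ + _); rewrite addrC.
have NB U W : N (U - W) = N U - N W.
  have adB : ad_mx (U - W) = ad_mx U - ad_mx W by apply: linearB.
  rewrite /N adB scalerBr; move: (ad_mx U) (ad_mx W) => p q.
  by rewrite opprD addrACA -opprD.
have iterNB k U W : iter k N (U - W) = iter k N U - iter k N W.
  by elim: k => //= k ->.
have LR W : Lx (Ry W) = Ry (Lx W) by rewrite /Lx /Ry /= mulmxA.
have L0 : Lx 0 = 0 by rewrite /Lx mulmx0.
have R0 : Ry 0 = 0 by rewrite /Ry /= mul0mx.
have iter0 (f : 'M[K]_n -> 'M[K]_n) k : f 0 = 0 -> iter k f 0 = 0.
  by move=> f0; elim: k => //= k ->.
have iterLR k W : iter k Lx (Ry W) = Ry (iter k Lx W).
  by elim: k => //= k ->.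
have iterRL k W : iter k Ry (Lx W) = Lx (iter k Ry W).
  by elim: k => //= k ->.
have N0 : N 0 = 0 by rewrite ND L0 R0 subr0.
have [m] := ubnP (a + b).
elim: m a b Z => // m IHm [|a] [|b] Z; rewrite ltnS => le_m.
- by move=> /= ->.
- by move=> Z0 _; rewrite [Z]Z0 iter0.
- by move=> _ Z0; rewrite [Z]Z0 iter0.
(* One application of [N] passes to [Lx Z] and [Ry Z], which lowers [a] or [b] by one. *)
move=> La Rb; rewrite addSn iterSr ND iterNB.
have -> : iter (a + b.+1) N (Lx Z) = 0.
  by rewrite IHm // -?iterSr // iterRL Rb.
rewrite addnS -addSn (IHm a.+1 b) ?subr0 // -?iterSr ?iterLR ?La //.
by rewrite addSn -addnS.
Qed.

End AdjointAction.

(* Here [D] is the polynomial in [A] that acts on the generalized eigenspace of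
   [x] as the scalar [f x]. Its adjoint is then a polynomial in [ad A], because
   [ad A] has generalized eigenvalues [x - y]. *)
Lemma ad_horner_mx (K : fieldType) n (A P T : 'M[K]_n.+1) (f g : K -> K) :
    P \in unitmx -> is_trig_mx T -> P *m A = T *m P ->
    (forall i j, g (T i i - T j j) = f (T i i) - f (T j j)) ->
  exists D r : {poly K},
    [/\ forall i, D.[T i i] = f (T i i), r`_0 = 0 &
        forall Z, ad_mx (horner_mx A D) Z = lin_horner (ad_mx A) r Z].
Proof.
move=> uP trT PA fg; pose s := [seq T i i | i <- enum 'I_n.+1].
have size_s : size s = n.+1 by rewrite size_map size_enum_ord.
have sP i : T i i \in s by apply: map_f; rewrite mem_enum.
(* The exponent [n.+1] bounds every multiplicity in the characteristic polynomial, which therefore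
   divides [q]; Cayley-Hamilton concludes. *)
have annA q : {in s, forall x, ('X - x%:P) ^+ n.+1 %| q} -> horner_mx A q = 0.
  move=> dv_q; suffices /dvdpP[u ->] : char_poly T %| q.
    by rewrite rmorphM /= (horner_mx_similar_char_poly uP PA) mulr0.
  rewrite (char_poly_trig trT) -(big_enum _ _ _ (fun i => 'X - (T i i)%:P)) /=.
  rewrite -(big_map (fun i => T i i) xpredT (fun x => 'X - x%:P)).
  by apply: dvdp_prod_XsubC_pow; rewrite size_s.
have [D DP] := poly_chinese_powers s f n.+1.
pose s2 := [seq x - y | x <- s, y <- s].
(* The exponent is the bound a + b of [iter_ad_mx_gen_eigen] for a = b = [n.+1]. *)
have [r rP] := poly_chinese_powers s2 g (n.+1 + n.+1).
have horner_val (q : {poly K}) x c m :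
    ('X - x%:P) ^+ m.+1 %| q - c%:P -> q.[x] = c.
  move=> /dvdpP[u Du]; rewrite -[q](subrK c%:P) Du exprSr mulrA.
  by rewrite !hornerE subrr mulr0 add0r.
exists D, r; split=> [i | | Z].
- exact: horner_val (DP _ (sP i)).
(* Zero is a difference of eigenvalues, so the constant term of [r] is the value of [g] at 0, which
   is 0. *)
- have s2_0 : T 0 0 - T 0 0 \in s2 by apply: allpairs_f.
  rewrite -horner_coef0 -(subrr (T 0 0)) (horner_val _ _ _ _ (rP _ s2_0)).
  by rewrite fg !subrr.
pose t := undup s.
(* The [E x] below are the spectral projections of [A], one per distinct eigenvalue. The
   divisibilities go through the boolean [all] so that [xchoose] applies. *)
have e_ex x : exists p : {poly K},
    all (fun y => ('X - y%:P) ^+ n.+1 %| p - (x == y)%:R) s.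
  have [p pP] := poly_chinese_powers s (fun y => (x == y)%:R) n.+1.
  by exists p; apply/allP=> y s_y; rewrite -(rmorph_nat polyC) pP.
pose e x := xchoose (e_ex x).
have eP x : {in s, forall y, ('X - y%:P) ^+ n.+1 %| e x - (x == y)%:R}.
  exact/allP/(xchooseP (e_ex x)).
pose E x := horner_mx A (e x).
have sumE : \sum_(x <- t) E x = 1.
  suffices : horner_mx A (\sum_(x <- t) e x - 1) = 0.
    by rewrite rmorphB rmorph1 rmorph_sum => /subr0_eq.
  apply: annA => y s_y.
  rewrite (bigD1_seq y) ?mem_undup ?undup_uniq //= addrAC dvdp_addl.
    by have := eP y y s_y; rewrite eqxx.
  apply: (big_ind (fun q => _ %| q)) => [|p q|x neq_xy]; rewrite ?dvdp0 //.
    exact: dvdp_add.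
  by have := eP x y s_y; rewrite (negPf neq_xy) subr0.
have annE q x : x \in s -> ('X - x%:P) ^+ n.+1 %| q -> horner_mx A q *m E x = 0.
  move=> s_x dv_q; have <- : horner_mx A (q * e x) = horner_mx A q *m E x.
    by rewrite rmorphM.
  apply: annA => y s_y.
  have [<- | neq_xy] := eqVneq x y; first by rewrite dvdp_mulr.
  by have := eP x y s_y; rewrite (negPf neq_xy) subr0; apply: dvdp_mull.
have DE x : x \in s -> horner_mx A D *m E x = f x *: E x.
  move=> s_x; apply/eqP; rewrite -subr_eq0 -mul_scalar_mx -mulmxBl.
  by rewrite -(horner_mx_C A) -(rmorphB (horner_mx A)) annE ?DP.
have XE x : x \in s -> iter n.+1 (mulmx (A - x%:M)) (E x) = 0.
  move=> s_x; suffices <- k :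
      (A - x%:M) ^+ k *m E x = iter k (mulmx (A - x%:M)) (E x).
    rewrite -(horner_mx_C A) -[X in X - _](horner_mx_X A).
    by rewrite -(rmorphB (horner_mx A)) -(rmorphXn (horner_mx A)) annE.
  elim: k => [|k IHk]; first by rewrite expr0 mul1mx.
  by rewrite exprS -mulmxA IHk.
have ED x : horner_mx A D *m E x = E x *m horner_mx A D.
  exact: comm_horner_mx2.
have EX x k :
    iter k (mulmxr (A - x%:M)) (E x) = iter k (mulmx (A - x%:M)) (E x).
  elim: k => //= k ->; elim: k => [|k IHk] /=; last by rewrite -mulmxA IHk.
  rewrite -(horner_mx_C A) -{1 3}(horner_mx_X A) -(rmorphB (horner_mx A)).
  exact: comm_horner_mx2.
(* Each block [E x *m Z *m E y] is a generalized eigenvector of ad A for x - y, and both sides act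
   on it as the scalar f x - f y. *)
have -> : Z = \sum_(x <- t) \sum_(y <- t) E x *m Z *m E y.
  under eq_bigr do rewrite -mulmx_sumr sumE mulmx1.
  by rewrite -mulmx_suml sumE mul1mx.
rewrite linear_sum lin_horner_sumr; apply: eq_big_seq => x.
rewrite mem_undup => s_x; rewrite linear_sum lin_horner_sumr.
apply: eq_big_seq => y; rewrite mem_undup => s_y.
rewrite (@lin_horner_gen_eigen _ _ _ _ (x - y) (g (x - y)) (n.+1 + n.+1));
  first last.
- apply: iter_ad_mx_gen_eigen.
    suffices -> k : iter k (mulmx (A - x%:M)) (E x *m Z *m E y) =
      iter k (mulmx (A - x%:M)) (E x) *m Z *m E y by rewrite XE // !mul0mx.
    by elim: k => //= k ->; rewrite !mulmxA.
  suffices -> k : iter k (mulmxr (A - y%:M)) (E x *m Z *m E y) =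
     E x *m Z *m iter k (mulmxr (A - y%:M)) (E y) by rewrite EX XE // !mulmx0.
  by elim: k => //= k ->; rewrite !mulmxA.
- by apply: rP; apply: allpairs_f.
have [/mapP[i _ ->] /mapP[j _ ->]] := (s_x, s_y).
rewrite fg /= /ad_mx !mulmxA DE ?sP // -[X in _ - X]mulmxA -ED DE ?sP //.
by rewrite -!scalemxAr -!scalemxAl -scalerBl.
Qed.

Lemma mxtrace_ad_mx_mulr (K : fieldType) n (Y Z D : 'M[K]_n) :
  \tr (ad_mx Y Z *m D) = - \tr (Y *m ad_mx D Z).
Proof.
rewrite /ad_mx mulmxBl mulmxBr !linearB /= opprB -!mulmxA; congr (_ - _).
by rewrite mxtrace_mulC -!mulmxA.
Qed.

Lemma map_iter_ad_mx (F K : fieldType) (h : {rmorphism F -> K})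
    n k (A Z : 'M_n) :
  map_mx h (iter k (ad_mx A) Z) = iter k (ad_mx (map_mx h A)) (map_mx h Z).
Proof. by elim: k => //= k <-; rewrite /ad_mx map_mxB !map_mxM. Qed.

(** Apply the hypothesis to the relation l i - l j - l i' + l j' = 0. This makes the functional well
    defined on eigenvalues and on their differences. *)
Lemma int_relation_diff (K : fieldType) n (l : 'I_n -> K) (c : 'I_n -> int) :
    (forall q : 'I_n -> int, \sum_i l i *~ q i = 0 -> \sum_i q i * c i = 0) ->
  forall i j i' j', l i - l j = l i' - l j' -> c i - c j = c i' - c j'.
Proof.
move=> rel_c i j i' j' eq_l.
have sum_delta (V : zmodType) (g : 'I_n -> V) k :
    \sum_m g m *~ (m == k)%:Z = g k.
  rewrite (bigD1 k) //= eqxx mulr1z big1 ?addr0 // => m /negPf->.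
  by rewrite mulr0z.
pose q m : int := (m == i)%:Z - (m == j)%:Z - ((m == i')%:Z - (m == j')%:Z).
have sum_q (V : zmodType) (g : 'I_n -> V) :
    \sum_m g m *~ q m = g i - g j - (g i' - g j').
  under eq_bigr do rewrite !mulrzBr.
  by rewrite !sumrB !sum_delta.
have /rel_c : \sum_m l m *~ q m = 0 by rewrite sum_q eq_l subrr.
under eq_bigr do rewrite mulrC -[q _]intz mulrzr.
by rewrite sum_q => /subr0_eq.
Qed.

(* If the eigenvalues [T i i] of [A] do not all vanish, an integral functional
   on them takes values [c i], not all zero. The trace of [A] times the
   polynomial in [A] with eigenvalues [c i] is [\sum_i c i * T i i], and the hypothesis on
   traces makes it zero. Applying the functional once more gives
   [\sum_i c i ^+ 2 = 0]. *)
Lemma nilpotent_of_traces (F : fieldType) n (A : 'M[F]_n)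
    (s : seq ('M[F]_n * 'M[F]_n)) :
    [pchar F] =i pred0 -> A = \sum_(w <- s) ad_mx w.1 w.2 ->
    (forall k, \sum_(w <- s) \tr (w.1 *m iter k.+1 (ad_mx A) w.2) = 0) ->
  A ^+ n = 0.
Proof.
case: n => [|n] in A s *; first by move=> *; apply/matrixP=> -[].
move=> char0F DA trA.
have [K [h [P [T [uP trT PA]]]]] := trigonalizable_ext A.
have char0 : [pchar K] =i pred0 by move=> x; rewrite (fmorph_pchar h).
suffices T0 i : T i i = 0.
  apply/eqP; rewrite -(map_mx_eq0 h) rmorphXn /=.
  have := horner_mx_similar_char_poly uP PA; rewrite (char_poly_trig trT).
  rewrite (eq_bigr (fun=> 'X)) => [|j _]; last by rewrite T0 subr0.
  by rewrite prodr_const card_ord rmorphXn /= horner_mx_X => ->.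
apply/eqP; apply: wlog_neg => Ti.
have [|c [[j0 cj0] rel_c]] :=
  @integral_functional K n.+1 (fun i => T i i) char0.
  by exists i.
have diff_c := int_relation_diff rel_c.
(* By [diff_c], the values of [f] and [g] do not depend on the index that [pick] returns; 0 is the
   default away from eigenvalues and their differences. *)
pose f x : K := if [pick j | T j j == x] is Some j then (c j)%:~R else 0.
pose g x : K :=
  if [pick jk : 'I_n.+1 * 'I_n.+1 | T jk.1 jk.1 - T jk.2 jk.2 == x] is Some jk
  then (c jk.1 - c jk.2)%:~R else 0.
have fT j : f (T j j) = (c j)%:~R.
  rewrite /f; case: pickP => [k /eqP Dk | /(_ j)]; last by rewrite eqxx.
  by congr (_%:~R); apply: (addIr (- c j)); apply: diff_c; rewrite Dk.
have gT j k : g (T j j - T k k) = f (T j j) - f (T k k).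
  rewrite !fT -rmorphB /g; case: pickP => [jk /eqP Djk | /(_ (j, k))].
    by congr (_%:~R); apply: diff_c.
  by rewrite eqxx.
have [D [r [DT r0 adD]]] := ad_horner_mx uP trT PA gT.
(* By invariance of the trace, tr (A D) is minus the sum of the tr (Y [D, Z]). As [D, -] is a
   polynomial in ad A without constant term, only traces that vanish by hypothesis occur. *)
have trAD : \tr (map_mx h A *m horner_mx (map_mx h A) D) = 0.
  rewrite {1}DA raddf_sum mulmx_suml raddf_sum /=.
  pose tm (w : 'M[F]_n.+1 * 'M[F]_n.+1) k :=
    \tr (w.1 *m iter k (ad_mx A) w.2).
  transitivity (- \sum_(k < size r) r`_k * h (\sum_(w <- s) tm w k));
    last first.
    rewrite big1 ?oppr0 // => -[[|k] lt_k] _ /=; first by rewrite r0 mul0r.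
    by rewrite trA rmorph0 mulr0.
  under [in RHS]eq_bigr do rewrite rmorph_sum mulr_sumr.
  rewrite [in RHS]exchange_big -[in RHS]sumrN /=. apply: eq_bigr => -[Y Z] _ /=.
  rewrite {1}/ad_mx map_mxB !map_mxM mxtrace_ad_mx_mulr adD; congr (- _).
  rewrite /lin_horner mulmx_sumr raddf_sum; apply: eq_bigr => k _ /=.
  rewrite -scalemxAr linearZ /= /tm -trace_map_mx map_mxM.
  by rewrite map_iter_ad_mx.
have /rel_c sum_c : \sum_j T j j *~ c j = 0.
  rewrite -[RHS]trAD -{1}(horner_mx_X (map_mx h A)).
  rewrite -[_ *m _](rmorphM (horner_mx _)).
  rewrite (mxtrace_horner_trig _ uP trT PA); apply: eq_bigr => j _.
  by rewrite hornerM hornerX DT fT mulrzr.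
case/eqP: cj0; have /eqP := sum_c; rewrite psumr_eq0 => [/allP/(_ j0)|j _].
  by rewrite mem_index_enum => /(_ isT); rewrite mulf_eq0 orbb => /eqP.
by rewrite -expr2 sqr_ge0.
Qed.

(** * Engel's theorem and left multiplications *)

Import VectorInternalTheory.

Section LeibnizTheory.

Variables (F : fieldType) (L : vectType F) (mul : {bilinear L -> L -> L}).
Local Notation n := (dim L).

Section Engel.

Hypothesis mulL : left_leibniz mul.
Implicit Types K W J : {vspace L}.

(* [tower K W j v]: every product of [j] left multiplications by elements of [K]
   maps [v] into [W]. *)
Fixpoint tower K W (j : nat) (v : L) : Prop :=
  if j is j'.+1 then forall k, k \in K -> tower K W j' (mul k v) else v \in W.

Lemma tower_lin K W j c u v :
  tower K W j u -> tower K W j v -> tower K W j (c *: u + v).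
Proof.
elim: j u v => [|j IHj] u v /=; first by move=> ? ?; rewrite memvD ?memvZ.
by move=> Ku Kv k Kk; rewrite linearPr; apply: IHj; [apply: Ku | apply: Kv].
Qed.

Lemma tower0 K W j : tower K W j 0.
Proof. by elim: j => [|j IHj] /= *; rewrite ?mem0v // linear0r. Qed.

Lemma towerS K j v : tower K 0 j v -> tower K 0 j.+1 v.
Proof.
elim: j v => [|j IHj] v; last by move=> Kv k Kk; apply/IHj/Kv.
by rewrite /= memv0 => /eqP-> k _; rewrite linear0r mem0v.
Qed.

Lemma tower_weaken K W j v : tower K 0 j v -> tower K W j v.
Proof.
elim: j v => [|j IHj] v /=; first by rewrite memv0 => /eqP->; rewrite mem0v.
by move=> Kv k Kk; apply/IHj/Kv.
Qed.

Lemma iter_mul_lin x i c u v :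
  iter i (mul x) (c *: u + v) = c *: iter i (mul x) u + iter i (mul x) v.
Proof. by elim: i => //= i ->; rewrite linearPr. Qed.

(** By the Leibniz identity, k (x v) = (k x) v + x (k v), where k x stays in [K] and k v lies one
    level lower. *)
Lemma tower_normalized K x j v :
    (forall k, k \in K -> mul k x \in K) ->
  tower K 0 j v -> tower K 0 j (mul x v).
Proof.
move=> Kx; elim: j v => [|j IHj] v /=.
  by rewrite memv0 => /eqP->; rewrite linear0r mem0v.
move=> Kv k Kk; rewrite mulL -[mul (mul k x) v]scale1r.
by apply: tower_lin; [apply/Kv/Kx | apply/IHj/Kv].
Qed.

(** As long as some k in [K] keeps k v outside [K], replace v by k v. The tower bounds the number of
    moves, and the last vector reached is the required x. *)
Lemma normalizer_outside K J j v :
    (forall x y, x \in J -> y \in J -> mul x y \in J) -> (K <= J)%VS ->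
    v \in J -> v \notin K -> tower K K j v ->
  exists x, [/\ x \in J, x \notin K & forall k, k \in K -> mul k x \in K].
Proof.
move=> mulJ sKJ; elim: j v => [|j IHj] v Jv K'v /=.
  by rewrite (negPf K'v).
have [[k Kk K'kv] Kv | no_k _] :=
    classic (exists2 k, k \in K & mul k v \notin K).
  apply: (IHj (mul k v)) => //; last exact: Kv.
  by apply: mulJ => //; apply: (subvP sKJ).
exists v; split=> // k Kk; apply: contra_notT no_k => K'kv.
by exists k.
Qed.

(** Let F_j be the vectors killed by j multiplications from [K]; it is stable under x. On F_(j+1)
    modulo F_j, an element k + c x acts as c x, so [p] multiplications lead from F_(j+1) into
    F_j. *)
Lemma tower_adjoin K x p :
    (forall k, k \in K -> mul k x \in K) ->
    (forall v, iter p (mul x) v = 0) ->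
  forall j v, tower K 0 j v -> tower (K + <[x]>) 0 (j * p) v.
Proof.
move=> Kx xp0; elim=> [//|j IHj] v Kv; rewrite mulSn.
suffices gen i w : tower K 0 j.+1 w -> tower K 0 j (iter i (mul x) w) ->
    tower (K + <[x]>) 0 (i + j * p) w.
  by apply: gen; rewrite // xp0; apply: tower0.
elim: i w => [|i IHi] w Kw iw; first exact: IHj.
move=> _ /memv_addP[k Kk [_ /vlineP[c ->] ->]].
rewrite addrC linearPl /=; apply: IHi.
  by apply: tower_lin; [apply: tower_normalized | apply/towerS/Kw].
rewrite iter_mul_lin; apply: tower_lin; first by rewrite -iterSr.
elim: (i) => [|m IHm]; [exact: Kw | exact: tower_normalized].
Qed.

(* Jacobson's argument: a subspace [K] of [J] that acts strictly nilpotently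
   and differs from [J] is normalized by some [x] in [J] outside [K], and
   [K + <[x]>] still acts strictly nilpotently. [K] need not be a subalgebra. *)
Lemma engel J p :
    (forall x y, x \in J -> y \in J -> mul x y \in J) ->
    (forall x v, x \in J -> iter p (mul x) v = 0) ->
  exists N, forall v, tower J 0 N v.
Proof.
move=> mulJ Jp0.
have [K [sKJ [N KN] [<- | ]]] : exists K, [/\ (K <= J)%VS,
    exists N, forall v, tower K 0 N v & K = J \/ (\dim J < \dim K)%N].
(* The inequality [\dim J < \dim K] is [(\dim J).+1 <= \dim K], so the induction produces some [K]
   that equals [J] or has dimension at least [d]. In the end the second case contradicts
   [K <= J]. *)
- elim: (\dim J).+1 => [|d [K [sKJ [N KN] [eqKJ | ltdK]]]].
  + exists 0%VS; split; rewrite ?sub0v //; last by right.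
    by exists 1%N => v k /=; rewrite !memv0 => /eqP->; rewrite linear0l.
  + by exists K; split; [|exists N|left].
  have [sJK | /subvPn[v Jv K'v]] := boolP (J <= K)%VS.
    by exists K; split; [|exists N|left; apply/eqP; rewrite eqEsubv sKJ].
  have [x [Jx K'x Kx]] :=
    normalizer_outside mulJ sKJ Jv K'v (tower_weaken _ (KN v)).
  exists (K + <[x]>)%VS; split; first by rewrite subv_add sKJ -memvE.
    exists (N * p)%N => w; apply: tower_adjoin => // u; exact: Jp0.
  right; apply: leq_ltn_trans ltdK _.
  rewrite (ltn_leqif (dimv_leqif_sup (addvSl _ _))).
  by rewrite subv_add subvv -memvE.
- by exists N.
by move/(leq_trans) => /(_ _ (dimvS sKJ)); rewrite ltnn.
Qed.

End Engel.

(* Matrices act on row vectors, which reverses composition; the sign restores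
   [left_mx (mul x y) = [left_mx x, left_mx y]]. *)
Definition left_mx (x : L) : 'M[F]_n := - lin1_mx (v2r \o mul x \o r2v).

Lemma mul_left_mx x v : v2r v *m left_mx x = - v2r (mul x v).
Proof. by rewrite mulmxN mul_rV_lin1 /= v2rK. Qed.

Lemma eq_on_v2r m (A B : 'M[F]_(n, m)) :
  (forall v : L, v2r v *m A = v2r v *m B) -> A = B.
Proof.
move=> eqAB; apply/row_matrixP=> i.
by rewrite !rowE -[delta_mx _ _]r2vK eqAB.
Qed.

Lemma left_mx_linear : linear left_mx.
Proof.
move=> c x y; apply: eq_on_v2r => v; rewrite mulmxDr -scalemxAr !mul_left_mx.
by rewrite linearPl /= linearP opprD scalerN.
Qed.
HB.instance Definition _ :=
  GRing.isLinear.Build F L _ _ left_mx left_mx_linear.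

Lemma left_mx_mul x y : left_leibniz mul ->
  left_mx (mul x y) = ad_mx (left_mx x) (left_mx y).
Proof.
move=> mulL; apply: eq_on_v2r => v; rewrite /ad_mx mulmxBr !mulmxA !mul_left_mx.
rewrite !mulNmx !mul_left_mx !opprK (mulL x y v) linearD opprD addrCA.
by rewrite subrr addr0.
Qed.
End LeibnizTheory.

(** * The Killing form of a Leibniz algebra *)

Section Derived.
Variables (F : fieldType) (L : vectType F) (mul : {bilinear L -> L -> L}).
Implicit Types U V : {vspace L}.

(** A subspace, unlike the predicates of [derived], so that dimensions can be compared; by
    bilinearity, products of basis vectors suffice. *)
Definition sqv U : {vspace L} :=
  <<[seq mul x y | x <- vbasis U, y <- vbasis U]>>%VS.

Lemma memv_mul_sqv U x y : x \in U -> y \in U -> mul x y \in sqv U.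
Proof.
move=> Ux Uy; rewrite (coord_vbasis Ux) (coord_vbasis Uy) linear_sumlz.
apply: memv_suml => i _; rewrite linear_sumr; apply: memv_suml => j _.
rewrite linearZr_LR linearZl_LR /= !memvZ // memv_span //.
by apply: allpairs_f; apply: mem_nth; rewrite size_tuple.
Qed.

Lemma sqv_sub U V : (forall x y, x \in U -> y \in U -> mul x y \in V) ->
  (sqv U <= V)%VS.
Proof.
move=> UV; apply/span_subvP=> _ /allpairsP[[x y] [/= Ux Uy ->]].
by apply: UV; apply: vbasis_mem.
Qed.

Lemma sqvS U V : (U <= V)%VS -> (sqv U <= sqv V)%VS.
Proof.
move/subvP=> sUV; apply: sqv_sub => x y Ux Uy.
by apply: memv_mul_sqv; apply: sUV.
Qed.

Lemma sqvP U v : v \in sqv U -> exists2 s : seq (L * L),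
  {in s, forall w, w.1 \in U /\ w.2 \in U} & v = \sum_(w <- s) mul w.1 w.2.
Proof.
rewrite /sqv; set X := (X in <<X>>%VS) => Xv.
have XP : {in X, forall z, exists x y, [/\ x \in U, y \in U & z = mul x y]}.
  by move=> _ /allpairsP[[x y] [/= Ux Uy ->]]; exists x, y; rewrite !vbasis_mem.
have {Xv} : v \in <<in_tuple X>>%VS by [].
move/coord_span=> ->; elim/big_rec: _ => [|i z _ [s Us ->]].
  by exists [::]; rewrite ?big_nil.
have /XP[x [y [Ux Uy ->]]] : (in_tuple X)`_i \in X by apply: mem_nth.
set c := coord _ _ _; exists ((c *: x, y) :: s); last first.
  by rewrite big_cons /= linearZl_LR.
by move=> w; rewrite inE => /predU1P[->|/Us] //=; rewrite memvZ.
Qed.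

Lemma derived_iter_sqv U m v : derived mul U m v -> v \in iter m sqv U.
Proof.
elim: m v => [//|m IHm] v [s sP]; apply: subvP.
apply/span_subvP=> u /sP[x [y [Dx Dy ->]]].
by apply: memv_mul_sqv; apply: IHm.
Qed.

(** Otherwise the dimension would drop at every step of the descending chain. *)
Lemma sqv_stationary U : (sqv U <= U)%VS ->
  exists m, sqv (iter m sqv U) = iter m sqv U.
Proof.
move=> sU; apply: NNPP => no_m.
have decr m : (iter m.+1 sqv U <= iter m sqv U)%VS.
  by elim: m => //= m; apply: sqvS.
suffices /(_ (\dim U).+1) : forall m, (\dim (iter m sqv U) + m <= \dim U)%N.
  by apply/negP; rewrite -ltnNge addnS ltnS leq_addl.
elim=> [|m IHm]; first by rewrite addn0.
apply: leq_trans IHm; rewrite addnS ltn_add2r.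
rewrite (ltn_leqif (dimv_leqif_sup (decr m))).
apply: contra_notN no_m => sm; exists m; apply/eqP.
by rewrite eqEsubv sm (decr m).
Qed.

End Derived.

Section Killing.

Variables (F : fieldType) (L : vectType F) (mul : {bilinear L -> L -> L}).
Hypothesis mulL : left_leibniz mul.
Local Notation n := (dim L).
Local Notation l := (left_mx mul).

Definition kill (x y : L) : F := \tr (l x *m l y).

Lemma killC x y : kill x y = kill y x.
Proof. exact: mxtrace_mulC. Qed.

Lemma kill_lin c x y z : kill (c *: x + y) z = c * kill x z + kill y z.
Proof. by rewrite /kill linearP mulmxDl -scalemxAl !linearP. Qed.

Lemma kill_mulA x y z : kill (mul x y) z = kill x (mul y z).
Proof.
rewrite /kill !left_mx_mul // /ad_mx mulmxBl mulmxBr !linearB /=; congr (_ - _).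
  by rewrite mulmxA.
by rewrite -mulmxA mxtrace_mulC -mulmxA.
Qed.

(** Left multiplication by a product is a commutator, hence antisymmetric even where the product
    itself is not. *)
Lemma left_mx_anti x y : l (mul x y) = - l (mul y x).
Proof. by rewrite !left_mx_mul // /ad_mx opprB. Qed.

Lemma kill_mulC x y z : kill (mul x y) z = - kill (mul y x) z.
Proof. by rewrite /kill left_mx_anti mulNmx linearN. Qed.

End Killing.

Section Gram.

Variables (F : fieldType) (L : vectType F).
Local Notation e := (fun i => r2v (delta_mx 0 i) : L).

Lemma functional_coord (phi : L -> F) :
    (forall c x y, phi (c *: x + y) = c * phi x + phi y) ->
  forall x, phi x = \sum_i v2r x 0 i * phi (e i).
Proof.
move=> phi_lin x; have phi0 : phi 0 = 0.
  apply: (addIr (phi 0)).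
  by rewrite -{2}[phi 0]mul1r addrC -phi_lin scale1r !add0r.
rewrite -{1}[x]v2rK {1}[v2r x]row_sum_delta linear_sum /=.
elim: (index_enum _) => [|i r IHr]; first by rewrite !big_nil.
by rewrite !big_cons linearZ phi_lin IHr.
Qed.

Definition gram (b : L -> L -> F) : 'M[F]_(dim L) :=
  \matrix_(i, j) b (e i) (e j).

Lemma mul_gram (b : L -> L -> F) :
    (forall c x y z, b (c *: x + y) z = c * b x z + b y z) ->
    (forall z c x y, b z (c *: x + y) = c * b z x + b z y) ->
  forall x y, v2r x *m gram b *m (v2r y)^T = (b x y)%:M.
Proof.
move=> bl br x y; rewrite [LHS]mx11_scalar; congr (_%:M); rewrite mxE.
rewrite (functional_coord (br x)); apply: eq_bigr => j _.
rewrite mulrC (functional_coord (fun c u v => bl c u v _)) !mxE; congr (_ * _).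
by apply: eq_bigr => i _; rewrite mxE.
Qed.

End Gram.

(** * The radical of the Killing form *)

Section KillingRadical.

Variables (F : fieldType) (L : vectType F) (mul : {bilinear L -> L -> L}).
Hypothesis mulL : left_leibniz mul.
Local Notation n := (dim L).
Local Notation l := (left_mx mul).
Local Notation kill := (kill mul).

Lemma kill_linr z c x y : kill z (c *: x + y) = c * kill z x + kill z y.
Proof. by rewrite !(killC _ z) kill_lin. Qed.

Definition killing_radical : {vspace L} := mx2vs (kermx (gram kill)).
Local Notation R := killing_radical.

Lemma mem_mx2vs m (A : 'M[F]_(m, n)) (x : L) :
  (x \in mx2vs A) = (v2r x <= A)%MS.
Proof. by rewrite memvE /subsetv !mx2vsK. Qed.

Lemma killing_radicalP x : x \in R <-> forall y, kill x y = 0.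
Proof.
rewrite mem_mx2vs; split=> [/sub_kermxP xG y | x0].
  have /matrixP/(_ 0 0) := mul_gram (@kill_lin _ _ mul) kill_linr x y.
  by rewrite xG mul0mx !mxE.
apply/sub_kermxP/rowP=> j.
have := mul_gram (@kill_lin _ _ mul) kill_linr x (r2v (delta_mx 0 j)).
rewrite r2vK trmx_delta -colE x0 => /matrixP/(_ 0 0).
by rewrite mxE => ->; rewrite !mxE.
Qed.

(** Invariance of the form handles a x; for x a, antisymmetry of left multiplications first reduces
    to a x. *)
Lemma killing_radical_ideal : ideal mul R.
Proof.
move=> a x /killing_radicalP a0; split; apply/killing_radicalP=> y.
  by rewrite kill_mulC // kill_mulA // a0 oppr0.
by rewrite kill_mulA.
Qed.

Lemma left_mx_iter x z k : iter k (ad_mx (l x)) (l z) = l (iter k (mul x) z).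
Proof. by elim: k => //= k ->; rewrite left_mx_mul. Qed.

Lemma mul_left_mx_exp x v k :
  v2r v *m l x ^+ k = (-1) ^+ k *: v2r (iter k (mul x) v).
Proof.
elim: k => [|k IHk]; first by rewrite expr0 mulmx1 scale1r.
rewrite exprSr mulmxA IHk -scalemxAl mul_left_mx scalerN -scaleNr.
by rewrite exprS mulN1r.
Qed.

Lemma perfect_sub_killing_radical_eq0 (J : {vspace L}) :
  [pchar F] =i pred0 -> sqv mul J = J -> (J <= R)%VS -> J = 0%VS.
Proof.
move=> char0 sqJ sJR.
have mulJ x y : x \in J -> y \in J -> mul x y \in J.
  by rewrite -{3}sqJ; apply: memv_mul_sqv.
have nilJ x v : x \in J -> iter n (mul x) v = 0.
  rewrite -{1}sqJ => /sqvP[s Js Dx].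
  have lx0 : l x ^+ n = 0.
    (* As [x] is a sum of products, [l x] is a sum of commutators, and the traces to be killed are
       values of [kill] at first arguments [w.1] in the radical. *)
    apply: (nilpotent_of_traces (s := [seq (l w.1, l w.2) | w <- s])) => //
      [|k].
      rewrite big_map {1}Dx linear_sum; apply: eq_bigr => w _.
      by rewrite /= left_mx_mul.
    rewrite big_map big_seq big1 // => w.
    case/Js=> /(subvP sJR)/killing_radicalP w0 _.
    by rewrite left_mx_iter; apply: w0.
  have /eqP := mul_left_mx_exp x v n.
  rewrite lx0 mulmx0 eq_sym scaler_eq0 signr_eq0 => /eqP /=.
  by rewrite -[0](linear0 v2r) => /v2r_inj.
have [N JN] := engel mulL mulJ nilJ.
have {JN} : forall v, v \in J -> tower mul J 0 N v by [].
(* Since [J] is spanned by products of its elements, one multiplication fewer already kills [J];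
   descending to none gives [J = 0]. *)
elim: N => [J0|N IHN JN].
  by apply/eqP; rewrite -subv0; apply/subvP=> v /J0.
apply: IHN => v; rewrite -{1}sqJ => /sqvP[s Js ->]; rewrite big_seq.
apply: big_ind => [|u w Ju Jw|w /Js[Jx Jy]]; first exact: tower0.
  by rewrite -[u]scale1r; apply: tower_lin.
exact: JN.
Qed.

Lemma killing_radical_solvable : [pchar F] =i pred0 -> solvable_subspace mul R.
Proof.
move=> char0; have sR : (sqv mul R <= R)%VS.
  by apply: sqv_sub => x y Rx _; have [] := killing_radical_ideal y Rx.
have [m Jm] := sqv_stationary sR; exists m => v /derived_iter_sqv.
rewrite (perfect_sub_killing_radical_eq0 char0 Jm) ?memv0 => [/eqP //|].
by elim: m {Jm} => //= m IHm; apply: subv_trans sR; apply: sqvS.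
Qed.

End KillingRadical.

(** * Vanishing of squares in the semi-simple left central case *)

Section SemisimpleLeftCentral.

Variables (F : fieldType) (L : vectType F) (mul : {bilinear L -> L -> L}).
Hypothesis char0 : [pchar F] =i pred0.
Hypotheses (LC : left_central_leibniz mul) (SS : semisimple_leibniz mul).
Local Notation n := (dim L).
Local Notation l := (left_mx mul).
Local Notation kill := (kill mul).
Let mulL : left_leibniz mul := LC.1.

Lemma killing_radical_right_center c :
  c \in killing_radical mul -> right_center mul c.
Proof.
move=> Rc; apply: LC.2; apply: SS Rc; first exact: killing_radical_ideal.
exact: killing_radical_solvable.
Qed.

(** The columns of the cokernel of [gram kill] are vectors of the radical, hence of the right
    center, so the Gram matrix of mu (x z) kills them too. It therefore factors as
    [D *m gram kill]. *)
Lemma killing_representation (mu : L -> F) :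
    (forall c x y, mu (c *: x + y) = c * mu x + mu y) ->
  exists D : 'M[F]_n, forall x y, kill (r2v (v2r x *m D)) y = mu (mul x y).
Proof.
move=> mu_lin; pose b x y := mu (mul x y).
have bl c x y z : b (c *: x + y) z = c * b x z + b y z.
  by rewrite /b linearPl /= mu_lin.
have br z c x y : b z (c *: x + y) = c * b z x + b z y.
  by rewrite /b linearPr /= mu_lin.
have kl := @kill_lin _ _ mul; have kr := @kill_linr _ _ mul.
have /submxP[D DG] : (gram b <= gram kill)%MS.
  rewrite submxE; move: (cokermx _) (mulmx_coker (gram kill)) => C GC0.
  apply/eqP/matrixP=> i j; rewrite [RHS]mxE.
  pose c := r2v (col j C)^T : L.
  have Rc : c \in killing_radical mul.
    apply/killing_radicalP=> y; rewrite killC.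
    have /matrixP/(_ 0 0) := mul_gram kl kr y c.
    rewrite r2vK trmxK -mulmxA colE (mulmxA (gram _)) GC0 mul0mx mulmx0.
    rewrite !mxE eqxx mulr1n.
    by move=> <-.
  have mu0 : mu 0 = 0.
    rewrite (functional_coord mu_lin) big1 // => k _.
    by rewrite linear0 mxE mul0r.
  have /matrixP/(_ 0 0) := mul_gram bl br (r2v (delta_mx 0 i)) c.
  rewrite !r2vK trmxK -rowE /b killing_radical_right_center // mu0.
  rewrite !mxE mul0rn => sum0; rewrite -[RHS]sum0.
  by apply: eq_bigr => k _; rewrite !mxE.
exists D => x y; have /matrixP/(_ 0 0) := mul_gram kl kr (r2v (v2r x *m D)) y.
rewrite r2vK -(mulmxA (v2r x)) -DG (mul_gram bl br) !mxE.
by [].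
Qed.

Lemma mul_self_eq0 x : mul x x = 0.
Proof.
apply: v2r_inj; rewrite linear0; apply/rowP=> t; rewrite [RHS]mxE.
pose mu y := (v2r y) 0 t.
have [|D DP] := @killing_representation mu.
  by move=> c y z; rewrite /mu linearP !mxE.
pose d y := r2v (v2r y *m D).
(* Paired with [w], the defect of the derivation rule becomes mu ((y z) w) - mu (y (z w)) + mu (z (y
   w)), which vanishes by the Leibniz identity. *)
have d_der y z : right_center mul (d (mul y z) - mul (d y) z - mul y (d z)).
  apply: killing_radical_right_center; apply/killing_radicalP=> w.
  have killB u v : kill (u - v) w = kill u w - kill v w.
    by rewrite -[- v]scaleN1r addrC kill_lin mulN1r addrC.
  rewrite !killB !DP (kill_mulC mulL y) !kill_mulA // !DP opprK.
  by rewrite (mulL y z w) /mu linearD mxE opprD addrA subrr add0r addNr.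
have vD v : v2r v *m D = v2r (d v) by rewrite r2vK.
(* The sign matches that of [left_mx]: on row vectors, [- D] represents [d]. *)
have adD Y : ad_mx (- D) Y = Y *m D - D *m Y.
  by rewrite /ad_mx mulNmx mulmxN opprK addrC.
(* The two first factors differ by a map into the right center, which the subsequent multiplication
   by [z] kills. *)
have ad_d y z : l (d y) *m l z = ad_mx (- D) (l y) *m l z.
  apply/eqP; rewrite -subr_eq0 -mulmxBl; apply/eqP; apply: eq_on_v2r => v.
  rewrite mulmx0 mulmxA.
  suffices -> : v2r v *m (l (d y) - ad_mx (- D) (l y)) =
      v2r (d (mul y v) - mul (d y) v - mul y (d v)).
    by rewrite mul_left_mx d_der linear0 oppr0.
  rewrite adD !mulmxBr !mulmxA vD !mul_left_mx mulNmx vD !linearB /=.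
  by rewrite !opprK addrCA addrA.
rewrite -[LHS]/(mu (mul x x)) -DP -/(d x) /kill ad_d adD mulmxBl linearB /=.
by rewrite -mulmxA mxtrace_mulC subrr.
Qed.

End SemisimpleLeftCentral.

Theorem corollary4p3 (F : fieldType) (char0 : [pchar F] =i pred0)
    (L : vectType F) (mul : {bilinear L -> L -> L}) :
  left_central_leibniz mul -> semisimple_leibniz mul -> lie mul.
Proof.
move=> LC SS; have sq0 := mul_self_eq0 char0 LC SS.
have anti x y : mul x y = - mul y x.
  apply/eqP; rewrite -addr_eq0; apply/eqP; have := sq0 (x + y).
  by rewrite linearDl !linearDr !sq0 add0r addr0.
split=> // x y z; rewrite (LC.1 x y z) (anti (mul x y) z) (anti z x) linearNr.
by rewrite addrK addNr.
Qed.
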